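(* Let $\Sigma=\{\mathsf{a},\mathsf{b}\}$ and $k\in\mathbb{N}_0$. Then the language $\mathcal{S}(\{\mathsf{a}\},\{\mathsf{b}\},k)$ contains every $x*y$-balanced string in $\Sigma^*$ of length at most $2k$.
   Context: $\Sigma^*$ is the set of finite strings over $\Sigma$, $\mathsf{e}$ the empty string; languages are subsets of $\Sigma^*$, with $+$ denoting union and juxtaposition denoting concatenation ($\mathcal{L}_1\mathcal{L}_2=\{st: s\in\mathcal{L}_1,t\in\mathcal{L}_2\}$, $\mathcal{L}^2=\mathcal{L}\mathcal{L}$). For $s\in\Sigma^*$, $|s|$ is its length, $|s|_{\mathsf{z}}$ the number of occurrences of letter $\mathsf{z}$, $s(i)$ its $i$-th letter. A string is balanced if $|s|_{\mathsf{a}}=|s|_{\mathsf{b}}$; it is $x*x$-balanced if balanced and $s(1)=s(|s|)$, and $x*y$-balanced if balanced and $s(1)\ne s(|s|)$; the empty string counts as both $x*x$- and $x*y$-balanced. For languages $\mathcal{L}_1,\mathcal{L}_2$: $\mathcal{S}(\mathcal{L}_1,\mathcal{L}_2,0)=\{\mathsf{e}\}$ and $\mathcal{S}(\mathcal{L}_1,\mathcal{L}_2,k)=\mathcal{L}_1\mathcal{S}(\mathcal{L}_1,\mathcal{L}_2,k-1)^2\mathcal{L}_2+\mathcal{L}_2\mathcal{S}(\mathcal{L}_1,\mathcal{L}_2,k-1)^2\mathcal{L}_1+\{\mathsf{e}\}$ for $k\ge1$. *)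

(* Defs.v *)
From HB Require Import structures.
From mathcomp Require Import all_boot.
From mathcomp Require Import classical_sets.

Set Implicit Arguments.
Unset Strict Implicit.
Unset Printing Implicit Defensive.

Local Open Scope classical_set_scope.

Definition language (Sigma : Type) := set (seq Sigma).

Definition lang_cat (Sigma : Type) (L1 L2 : language Sigma) : language Sigma :=
  [set s ++ t | s in L1 & t in L2].

Fixpoint lang_S (Sigma : Type) (L1 L2 : language Sigma) (k : nat) :
    language Sigma :=
  if k is k'.+1 then
    let S2 := lang_cat (lang_S L1 L2 k') (lang_S L1 L2 k') in
    lang_cat (lang_cat L1 S2) L2 `|` lang_cat (lang_cat L2 S2) L1
      `|` [set [::]]
  else [set [::]].

Inductive letter : predArgType := La | Lb.

Definition is_a (x : letter) : bool := if x is La then true else false.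
Definition of_is_a (c : bool) : letter := if c then La else Lb.
Lemma is_aK : cancel is_a of_is_a.
Proof. by case. Qed.

HB.instance Definition _ := Equality.copy letter (can_type is_aK).

Definition balanced (s : seq letter) : Prop := count_mem La s = count_mem Lb s.

(* The empty string, which has no first letter, counts as x*y-balanced. *)
Definition xy_balanced (s : seq letter) : Prop :=
  balanced s /\ (if s is x :: t then x <> last x t else True).

(* Main.v *)
Require Import Defs.
From mathcomp Require Import all_boot.
From mathcomp Require Import classical_sets.
From mathcomp Require Import zify.

(** Deleting the first and last letters of a nonempty x*y-balanced string leaves
    a balanced string, so it suffices to split every balanced string into two
    x*y-balanced ones.  If the string begins and ends with the same letter [x],
    then the walk that steps up at [x] and down at the other letter [y] goes
    from height 1 (after the first letter) to height -1 (before the last one).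
    Where it first becomes negative, it has just crossed 0 with two consecutive
    steps [y]; cutting between them gives a factor [x...y] and a factor
    [y...x], both balanced. *)

Local Open Scope classical_set_scope.

Lemma letter_neq_eq (x y z : letter) : x <> y -> z <> x -> z = y.
Proof. by case: x; case: y; case: z. Qed.

Lemma count_cons_letter (z x : letter) (s : seq letter) :
  count_mem z (x :: s) = (x == z) + count_mem z s.
Proof. by []. Qed.

Lemma count_rcons_letter (z x : letter) (s : seq letter) :
  count_mem z (rcons s x) = count_mem z s + (x == z).
Proof. by rewrite -cats1 count_cat /= addn0. Qed.

Lemma balancedE (x y : letter) (s : seq letter) :
  x <> y -> balanced s <-> count_mem x s = count_mem y s.
Proof. by rewrite /balanced; case: x; case: y => // _; split. Qed.

Lemma balanced_catr (s t : seq letter) :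
  balanced s -> balanced (s ++ t) -> balanced t.
Proof. by rewrite /balanced !count_cat; lia. Qed.

Lemma balanced_strip (x y : letter) (u : seq letter) :
  x <> y -> balanced (x :: rcons u y) -> balanced u.
Proof.
move=> nxy; rewrite !(balancedE _ _ _ nxy) !(count_cons_letter, count_rcons_letter) !eqxx.
by have [//|_] := x =P y; have [/esym//|_] := y =P x; lia.
Qed.

(** Induction on length, passing to shorter prefixes where [y] still outnumbers [x]. The default in
    [last y p] lets an empty [p] count as ending in [y]. *)
Lemma zero_crossing (x y : letter) (s : seq letter) :
  x <> y -> count_mem x s < count_mem y s ->
  exists p q, [/\ s = p ++ y :: q, balanced p & last y p = y].
Proof.
move=> nxy; have [n] := ubnP (size s).
elim: n s => // n IHn s; case/lastP: s => [//|s z].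
rewrite size_rcons ltnS => sn ltxy.
(* A cut found in a prefix [s'] is a cut of the whole string: the rest [r] joins [q]. *)
have shrink s' r : rcons s z = s' ++ r -> size s' < n ->
    count_mem x s' < count_mem y s' ->
    exists p q, [/\ rcons s z = p ++ y :: q, balanced p & last y p = y].
  move=> -> s'n /IHn -/(_ s'n) [p [q [-> bp lp]]].
  by exists p, (q ++ r); rewrite -catA.
have [ltxy'|leyx] := ltnP (count_mem x s) (count_mem y s).
  by apply: (shrink s [:: z]); rewrite ?cats1.
have [zx|/(letter_neq_eq _ _ _ nxy) zy] := z =P x.
  move: ltxy; rewrite !count_rcons_letter zx eqxx.
  by have [//|_] := x =P y; lia.
subst z; move: ltxy; rewrite !count_rcons_letter eqxx.
have [/esym//|_] := y =P x; move=> ltxy.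
(* [s] has no excess of [y], yet one more [y] creates one, so the counts agree. *)
have bs : balanced s by apply/(balancedE _ _ _ nxy); lia.
have [ly|nly] := last y s =P y.
  by exists s, [::]; rewrite cats1.
case/lastP: s nly sn leyx ltxy bs shrink => [//|s w].
rewrite last_rcons size_rcons => wy sn _ ltxy _ shrink.
have wx : w = x by apply: letter_neq_eq wy => /esym.
(* Dropping the final [x] of a balanced string leaves one [y] in excess. *)
apply: (shrink s [:: w; y]); [by rewrite -!cats1 -catA | exact: ltnW |].
move: ltxy; rewrite !count_rcons_letter wx eqxx.
by have [//|_] := x =P y; lia.
Qed.

Lemma balanced_split (s : seq letter) :
  balanced s -> exists u v, [/\ s = u ++ v, xy_balanced u & xy_balanced v].
Proof.
case: s => [|x t] bs; first by exists [::], [::].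
have [xl|nxl] := x =P last x t; last by exists (x :: t), [::]; rewrite cats0.
pose y := of_is_a (~~ is_a x).
have nxy : x <> y by rewrite /y; case: (x).
move/(balancedE _ _ _ nxy): (bs).
case/lastP: t xl bs => [|t z]; first by move=> _ _ /=; case: eqP; case: eqP.
rewrite last_rcons => <- bs.
rewrite !(count_cons_letter, count_rcons_letter) eqxx.
have [//|_] := x =P y; move=> cnt.
(* The whole string is balanced, so without its last [x] there is one [y] in excess. *)
have [|p [q [E bp lp]]] := zero_crossing x y (x :: t) nxy.
  by rewrite !count_cons_letter eqxx; have [//|_] := x =P y; lia.
(* An empty [p] would force [x = y]; so [p] begins with [x] and, by [lp], ends in [y]. *)
case: p E bp lp => [[/nxy]//|w p] [<- tE] bp lp.
exists (x :: p), (y :: rcons q x); split.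
- by rewrite tE rcons_cat.
- by split=> //; rewrite -[last x p]/(last y (x :: p)) lp.
- split; last by rewrite last_rcons => /esym.
  by apply: balanced_catr bp _; rewrite /= -rcons_cons -rcons_cat -tE.
Qed.

Lemma lang_S_nil (Sigma : Type) (L1 L2 : language Sigma) (k : nat) :
  lang_S L1 L2 k [::].
Proof. by case: k => [|k] //; right. Qed.

Theorem theorem2 (k : nat) (s : seq letter) (hs : xy_balanced s)
  (hk : size s <= 2 * k) :
  lang_S [set [:: La]] [set [:: Lb]] k s.
Proof.
elim: k s hs hk => [|k IHk] [|x t] [bs hl] hk; try exact: lang_S_nil.
  by move: hk.
case/lastP: t bs hl hk => [//|t y]; rewrite last_rcons => bs nxy.
rewrite /= size_rcons => hk.
have [u [v [tE xyu xyv]]] := balanced_split t (balanced_strip _ _ _ nxy bs).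
have szt : size u + size v = size t by rewrite tE size_cat.
(* Stripping two letters leaves length at most [2 * k], enough for [u] or [v] even if the other is
   empty. *)
have Su : lang_S [set [:: La]] [set [:: Lb]] k u by apply: IHk => //; lia.
have Sv : lang_S [set [:: La]] [set [:: Lb]] k v by apply: IHk => //; lia.
left; rewrite tE.
have cat_mem (a b : letter) : lang_cat (lang_cat [set [:: a]]
    (lang_cat (lang_S [set [:: La]] [set [:: Lb]] k)
      (lang_S [set [:: La]] [set [:: Lb]] k))) [set [:: b]]
    (a :: rcons (u ++ v) b).
  exists (a :: (u ++ v)); last by exists [:: b]; rewrite ?cats1.
  by exists [:: a] => //; exists (u ++ v) => //; exists u => //; exists v.
(* The order of the two distinct end letters selects the summand. *)
by case: x y nxy {bs hk} => [] [] // _; [left|right]; apply: cat_mem.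
Qed.
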